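(* Let $\Gamma$ be a general network. The relation $\delta$ on $\mathcal{L}(\Gamma)$, defined by $(l_1,l_2)\in\delta$ if and only if $P_1=P_2$, where $l_1=\oplus(P_1|S_1)$ and $l_2=\oplus(P_2|S_2)$, is a congruence on $(\mathcal{L}(\Gamma),\mathring{\cup})$.
   Context: A general network $\Gamma$ has a finite vertex set $\Gamma^0$ and a finite set $T$ of tensors. A tensor $t=T_A^B$ is given by a non-empty set $A\subseteq\Gamma^0$ of covariant indexes and a (possibly empty) set $B\subseteq\Gamma^0$ of contra-variant indexes; its index set is $I(t)=A\cup B$. A 2-chain is an unordered pair $\oplus(t_i,t_j)$ of distinct tensors $t_i,t_j\in T$ with $I(t_i)\cap I(t_j)\neq\emptyset$. A (non-empty) tensor chain is $\oplus(P|S)$, where $P\subseteq T$ is non-empty, $S$ is a set of 2-chains between elements of $P$, and the pair is connected: any two distinct $t_i,t_j\in P$ are joined by a sequence $t_i=t_{k_1},\dots,t_{k_m}=t_j$ in $P$ with $\oplus(t_{k_\ell},t_{k_{\ell+1}})\in S$ for all $1\le \ell<m$. A tensor chain is determined by $(P,S)$; a single tensor $t$ is the chain with $P=\{t\}$, $S=\varnothing$. $\mathcal{L}(\Gamma)$ is the set of all non-empty tensor chains together with an extra element $\emptyset$ (the empty relation), whose tensor set is regarded as empty. Reducing: for non-empty chains $l_1=\oplus(P_1|S_1)$, $l_2=\oplus(P_2|S_2)$, put $l_1\mathring{\cup}l_2=\oplus(P_1\cup P_2|S_1\cup S_2)$ if $P_1\cap P_2\neq\varnothing$ and $l_1\mathring{\cup}l_2=\emptyset$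 otherwise; also $\emptyset\mathring{\cup}l=l\mathring{\cup}\emptyset=\emptyset$ for all $l$. An equivalence relation $\rho$ on a set $A$ with binary operation $*$ is a congruence if $(a,b)\in\rho$ implies $(c*a,c*b)\in\rho$ and $(a*c,b*c)\in\rho$ for all $a,b,c\in A$. *)

(* Defs.v *)
From HB Require Import structures.
From mathcomp Require Import all_boot.
From Corelib Require Import Relation_Definitions.

Set Implicit Arguments.
Unset Strict Implicit.
Unset Printing Implicit Defensive.

(* Tensors form an abstract finite type, so that distinct tensors may carry the
   same covariant and contra-variant indexes. *)
Record network := Network {
  vertex : finType;
  tensor : finType;
  covariant : tensor -> {set vertex};
  contravariant : tensor -> {set vertex};
  covariant_neq0 : forall t, covariant t != set0
}.

Definition index_set (G : network) (t : tensor G) : {set vertex G} :=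
  covariant t :|: contravariant t.

(* The unordered pair of t_i and t_j is the set [set t_i; t_j]. *)
Definition two_chain (G : network) (e : {set tensor G}) : bool :=
  [exists ti : tensor G, exists tj : tensor G,
    [&& ti != tj, index_set ti :&: index_set tj != set0 & e == [set ti; tj]]].

Definition chain_step (G : network) (P : {set tensor G})
    (S : {set {set tensor G}}) : rel (tensor G) :=
  fun ti tj => [&& ti \in P, tj \in P & [set ti; tj] \in S].

Definition chain_connected (G : network) (P : {set tensor G})
    (S : {set {set tensor G}}) : bool :=
  [forall ti in P, forall tj in P,
    (ti != tj) ==> connect (chain_step P S) ti tj].

Definition is_chain (G : network) (P : {set tensor G})
    (S : {set {set tensor G}}) : bool :=
  [&& P != set0,
      [forall e in S, two_chain e && (e \subset P)]
    & chain_connected P S].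

(* [is_chain] is boolean, so a chain is determined by (P, S). *)
Record chain (G : network) := Chain {
  chain_tensors : {set tensor G};
  chain_links : {set {set tensor G}};
  chainP : is_chain chain_tensors chain_links
}.

(* [None] is the empty relation. *)
Definition chains (G : network) : Type := option (chain G).

Definition tensors (G : network) (l : chains G) : {set tensor G} :=
  if l is Some c then chain_tensors c else set0.

Lemma connect_chain_stepS (G : network) (P Q : {set tensor G})
    (S U : {set {set tensor G}}) (ti tj : tensor G) :
  P \subset Q -> S \subset U -> chain_connected P S ->
  ti \in P -> tj \in P -> connect (chain_step Q U) ti tj.
Proof.
move=> /subsetP PQ /subsetP SU /forall_inP conn tiP tjP.
have [->|ne] := eqVneq ti tj; first exact: connect0.
have := implyP (forall_inP (conn _ tiP) _ tjP) ne.
apply: connect_sub => x y /and3P[xP yP xyS]; apply: connect1.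
by rewrite /chain_step PQ ?PQ ?SU.
Qed.

Lemma is_chainU (G : network) (P1 P2 : {set tensor G})
    (S1 S2 : {set {set tensor G}}) :
  is_chain P1 S1 -> is_chain P2 S2 -> P1 :&: P2 != set0 ->
  is_chain (P1 :|: P2) (S1 :|: S2).
Proof.
move=> /and3P[_ /forall_inP S1P c1] /and3P[_ /forall_inP S2P c2].
case/set0Pn=> t /setIP[t1 t2]; apply/and3P; split.
- by apply/set0Pn; exists t; rewrite inE t1.
- apply/forall_inP=> e /setUP[/S1P|/S2P] /andP[-> eP] /=.
    exact: subset_trans eP (subsetUl _ _).
  exact: subset_trans eP (subsetUr _ _).
have L x y : x \in P1 -> y \in P1 ->
    connect (chain_step (P1 :|: P2) (S1 :|: S2)) x y.
  by apply: connect_chain_stepS c1; exact: subsetUl.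
have R x y : x \in P2 -> y \in P2 ->
    connect (chain_step (P1 :|: P2) (S1 :|: S2)) x y.
  by apply: connect_chain_stepS c2; exact: subsetUr.
apply/forall_inP=> x /setUP xP; apply/forall_inP=> y /setUP yP.
apply/implyP=> _; apply: (@connect_trans _ _ t).
  by case: xP => xP; [exact: L | exact: R].
by case: yP => yP; [exact: L | exact: R].
Qed.

Definition reduce_chain (G : network) (c1 c2 : chain G)
    (H : chain_tensors c1 :&: chain_tensors c2 != set0) : chain G :=
  Chain (is_chainU (chainP c1) (chainP c2) H).

Definition reduce (G : network) (l1 l2 : chains G) : chains G :=
  match l1, l2 with
  | Some c1, Some c2 =>
    match boolP (chain_tensors c1 :&: chain_tensors c2 != set0) with
    | AltTrue H => Some (reduce_chain H)
    | AltFalse _ => None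
    end
  | _, _ => None
  end.

Definition congruence (A : Type) (op : A -> A -> A) (rho : relation A) : Prop :=
  equivalence A rho /\
  (forall a b c : A, rho a b -> rho (op c a) (op c b) /\ rho (op a c) (op b c)).

Definition delta (G : network) : relation (chains G) :=
  fun l1 l2 => tensors l1 = tensors l2.

(* Main.v *)
Require Import Defs.
From mathcomp Require Import all_boot.

(** The tensor set of a reduction is a function of the two tensor sets alone: links enter neither
    the test nor the union. As [delta] is the kernel of [tensors], it is an equivalence, and
    [reduce] respects it on both sides by substitution in [tensors_reduce]. *)

(* The empty relation needs no separate case, as its tensor set meets nothing. *)
Lemma tensors_reduce (G : network) (l1 l2 : chains G) :
  tensors (reduce l1 l2) =
  if tensors l1 :&: tensors l2 != set0 then tensors l1 :|: tensors l2 else set0.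
Proof.
case: l1 l2 => [c1|] [c2|] /=; rewrite ?set0I ?setI0 ?eqxx //.
(* [reduce_chain] consumes the proof found by the test, so the case is on that evidence itself;
   [{-}] leaves the test on the right in place, for each branch to rewrite. *)
case: {-}_ / boolP => [H|/negbTE->] //=.
by rewrite H.
Qed.

Theorem lemma3p3 (G : network) : congruence (@reduce G) (@delta G).
Proof.
split=> [|a b c ab]; last by rewrite /delta !tensors_reduce ab.
by split=> [l|l1 l2 l3 + +|l1 l2]; rewrite /delta => // ->.
Qed.
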